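(* Let $\mathfrak{T}$ be a tree that is ideal, monofolic, well-founded, focal and variegated, let $\mathcal{P}$ be the set of leafless paths of $\mathfrak{T}$ and let $\mathfrak{E}$ be the trivial tree. Then the tree $\mathfrak{T}+_{\mathcal{P}}\mathfrak{E}$ is bounded. Hence every tree that is ideal, monofolic, well-founded, focal and variegated can be elementarily embedded in a bounded tree.
   Context: A tree is a structure $\mathfrak{T}=(T;<)$ with $T$ non-empty and $<$ a strict partial order that is downwards linear (each set $\{x : x \leqslant t\}$ is totally ordered) and downwards connected (for all $s,t$ there is $x$ with $x\leqslant s$ and $x\leqslant t$). The language may be expanded by finitely many constants and unary predicates; $\mathcal{L}(\mathfrak{T})$ is the resulting first-order language. Elements of $T$ are called nodes. A path is a maximal linearly ordered subset; a leaf is a $<$-maximal node; a path is leafless (open) if it has no greatest element and closed (bounded) if it has one. A tree is bounded if each of its paths has a greatest element. Write $x \smile y$ if $x<y$, $y<x$ or $x=y$. Natural numbers include $0$. The trivial tree $\mathfrak{E}$ has one node and empty order. $\mathfrak{T}+_{\mathcal{P}}\mathfrak{E}$ is the tree obtained from $\mathfrak{T}$ by adding, for each path $A\in\mathcal{P}$, one new leaf $e_A$ whose set of strict predecessors is exactly $A$. Well-founded: every non-empty set of nodes has a minimal element. Ideal: for each leaf $x$ and each $y<x$ there is $z$ with $y<z<x$. Monofolic: for each leaf $x$ and each node $y$, if every $z<x$ satisfies $z<y$, then $y=x$. Focal: for each node $a$ and each $\mathcal{L}(\mathfrak{T})$-formula $\varphi(x,y)$, if there is $b\geqslant a$ with $\mathfrak{T}\models\varphi(a,b)$,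 then for each $c\geqslant a$ there is $d\geqslant a$ with $d\smile c$ and $\mathfrak{T}\models\varphi(a,d)$. $\equiv^n$ denotes agreement on all first-order sentences of quantifier rank at most $n$. For a finite relational language with constants, $\tau^n_1(x),\ldots,\tau^n_m(x)$ is the finite list (up to logical equivalence) of $n$-characteristic formulas in one free variable: formulas of quantifier rank $n$ such that each element of each structure satisfies exactly one of them, and $a$ in $\mathfrak{A}$ and $b$ in $\mathfrak{B}$ satisfy the same one iff $(\mathfrak{A};a)\equiv^n(\mathfrak{B};b)$. For a path $A$, $A^-$ is $A$ with its leaf (if any) removed. The $n$-spectrum of $A$ in $\mathfrak{T}$ is the set of $i$ for which $\{t\in A^- : \mathfrak{T}\models\tau^n_i(t)\}$ is cofinal in $A^-$ (formulas $\tau_i^n$ in the language $\mathcal{L}(\mathfrak{T})$). $\mathfrak{T}$ is variegated if for each natural number $n$, each open path $B$ in $\mathfrak{T}$ and each finite tuple $\bar a$ from $T$, if $B$ has $n$-spectrum $X$ in $(\mathfrak{T};\bar a)$ then there is a closed path $C$ in $\mathfrak{T}$ that also has $n$-spectrum $X$ in $(\mathfrak{T};\bar a)$ (characteristic formulas in the language $\mathcal{L}(\mathfrak{T};\bar a)$). *)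

(* Defs.v *)
From mathcomp Require Import all_boot.
From mathcomp Require Import boolp classical_sets.

Set Implicit Arguments.
Unset Strict Implicit.
Unset Printing Implicit Defensive.

Local Open Scope classical_set_scope.

(** * First-order logic over [<], finitely many constants and finitely many
    unary predicates *)

Record language := Language { nconst : nat; npred : nat }.

Record structure (L : language) := Structure {
  node :> Type;
  lt : node -> node -> Prop;
  cst : (nconst L).-tuple node;
  prd : 'I_(npred L) -> set node }.

Inductive term (L : language) (k : nat) :=
| Var of 'I_k
| Cst of 'I_(nconst L).

(* [formula L k] is the type of formulas with free variables among
   x_0, ..., x_(k-1).  [All] binds x_0 and shifts the other variables up.  The
   connectives are a complete set for classical logic. *)
Inductive formula (L : language) : nat -> Type :=
| Bot k : formula L k
| Eq k : term L k -> term L k -> formula L k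
| Lt k : term L k -> term L k -> formula L k
| Prd k : 'I_(npred L) -> term L k -> formula L k
| Imp k : formula L k -> formula L k -> formula L k
| All k : formula L k.+1 -> formula L k.

Arguments Var {L k}.
Arguments Cst {L k}.
Arguments Bot {L k}.

Fixpoint qr L k (phi : formula L k) : nat :=
  match phi with
  | Imp _ a b => maxn (qr a) (qr b)
  | All _ a => (qr a).+1
  | _ => 0
  end.

Definition eval L (M : structure L) k (v : k.-tuple M) (t : term L k) : M :=
  match t with Var i => tnth v i | Cst c => tnth (cst M) c end.

Fixpoint sat L (M : structure L) k (phi : formula L k) : k.-tuple M -> Prop :=
  match phi in formula _ k return k.-tuple M -> Prop with
  | Bot _ => fun=> False
  | Eq _ s t => fun v => eval v s = eval v t
  | Lt _ s t => fun v => lt (eval v s) (eval v t)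
  | Prd _ p t => fun v => prd p (eval v t)
  | Imp _ a b => fun v => sat a v -> sat b v
  | All _ a => fun v => forall x, sat a [tuple of x :: v]
  end.

Definition equivn L (n : nat) (M N : structure L) :=
  forall phi : formula L 0, qr phi <= n ->
    sat phi ([tuple] : 0.-tuple M) <-> sat phi ([tuple] : 0.-tuple N).

Definition elementary_embedding L (M N : structure L) (h : M -> N) :=
  forall k (phi : formula L k) (v : k.-tuple M),
    sat phi v <-> sat phi [tuple of map h v].

Definition expand_language (L : language) (k : nat) :=
  Language (nconst L + k) (npred L).

(* (M; a), with new constants naming the entries of the tuple a *)
Definition expand L (M : structure L) k (a : k.-tuple M) :
    structure (expand_language L k) :=
  @Structure (expand_language L k) M (@lt L M) [tuple of cst M ++ a] (@prd L M).

(* [taus] is a list of n-characteristic formulas in one free variable.  Such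
   lists exist: see [characteristic_exists]. *)
Definition characteristic L (n : nat) m (taus : m.-tuple (formula L 1)) :=
  [/\ forall i, qr (tnth taus i) = n,
      forall (M : structure L) (a : M), exists! i, sat (tnth taus i) [tuple a]
    & forall (M N : structure L) (a : M) (b : N),
        (forall i, sat (tnth taus i) [tuple a] <-> sat (tnth taus i) [tuple b])
        <-> equivn n (expand [tuple a]) (expand [tuple b])].

(** * Trees *)

Section Trees.
Variables (L : language) (T : structure L).
Implicit Types (x y z s t : T) (A B C : set T).

Definition le x y := lt x y \/ x = y.

Definition smile x y := [\/ lt x y, lt y x | x = y].

Definition is_tree :=
  [/\ inhabited T,
      forall x, ~ lt x x,
      forall x y z, lt x y -> lt y z -> lt x z,
      forall t, total_on [set x | le x t] le
    & forall s t, exists x, le x s /\ le x t].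

Definition is_path A :=
  total_on A le /\ forall B, total_on B le -> A `<=` B -> B `<=` A.

Definition leaf x := forall y, ~ lt x y.

Definition has_greatest A := exists2 x, A x & forall y, A y -> le y x.

Definition open_path A := is_path A /\ ~ has_greatest A.

Definition closed_path A := is_path A /\ has_greatest A.

Definition bounded_tree := forall A, is_path A -> has_greatest A.

Definition well_founded_tree :=
  forall A, A !=set0 -> exists2 x, A x & forall y, A y -> ~ lt y x.

Definition ideal :=
  forall x y, leaf x -> lt y x -> exists2 z, lt y z & lt z x.

Definition monofolic :=
  forall x y, leaf x -> (forall z, lt z x -> lt z y) -> y = x.

Definition focal :=
  forall (a : T) (phi : formula L 2),
    (exists2 b, le a b & sat phi [tuple a; b]) ->
    forall c, le a c -> exists d, [/\ le a d, smile d c & sat phi [tuple a; d]].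

Definition minus_leaf A : set T := [set t | A t /\ ~ leaf t].

Definition cofinal (S A : set T) := forall x, A x -> exists2 y, S y & le x y.

Definition spectrum m (taus : m.-tuple (formula L 1)) A : set 'I_m :=
  [set i | cofinal [set t | minus_leaf A t /\ sat (tnth taus i) [tuple t]]
                   (minus_leaf A)].

End Trees.

Definition variegated L (T : structure L) :=
  forall (n : nat) (B : set T), open_path B ->
  forall k (a : k.-tuple T) m (taus : m.-tuple (formula (expand_language L k) 1)),
    characteristic n taus ->
    forall X : set 'I_m, @spectrum _ (expand a) m taus B = X ->
    exists2 C : set T, closed_path C & @spectrum _ (expand a) m taus C = X.

(* The tree T +_P E, where E is the one-node tree whose node satisfies exactly
   the predicates in [U]; the choice of U is immaterial in the pure language of
   trees.  Proofs of [P A] being irrelevant ([boolp.Prop_irrelevance]), there is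
   exactly one new leaf per member of P. *)
Definition add_leaves L (T : structure L) (P : set (set T))
    (U : set 'I_(npred L)) : structure L :=
  @Structure L (T + {A : set T | P A})
    (fun x y => match x, y with
                | inl s, inl t => lt s t
                | inl s, inr e => sval e s
                | inr _, _ => False
                end)
    [tuple of map inl (cst T)]
    (fun p x => match x with inl t => prd p t | inr _ => U p end).

(** * Existence of characteristic formulas *)

Section Existence.

Definition Neg L k (a : formula L k) := Imp a Bot.
Definition And L k (a b : formula L k) := Neg (Imp a (Neg b)).
Definition Exi L k (a : formula L k.+1) := Neg (All (Neg a)).

Lemma sat_And L (M : structure L) k (a b : formula L k) (v : k.-tuple M) :
  sat (And a b) v <-> sat a v /\ sat b v.
Proof.
split=> /= [H|[ha hb]]; last by move/(_ ha); apply.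
by split; apply: contrapT => h; apply: H => // ha hb.
Qed.

Lemma sat_Exi L (M : structure L) k (a : formula L k.+1) (v : k.-tuple M) :
  sat (Exi a) v <-> exists x, sat a [tuple of x :: v].
Proof.
split=> /= [H|[x hx]]; last by move/(_ x); apply.
by apply: contrapT => h; apply: H => x hx; apply: h; exists x.
Qed.

Fixpoint pad L k n : formula L k :=
  if n is n'.+1 then All (pad L k.+1 n') else Neg Bot.

Lemma qr_pad L n k : qr (pad L k n) = n.
Proof. by elim: n k => //= n IH k; rewrite IH. Qed.

Lemma sat_pad L (M : structure L) n k (v : k.-tuple M) : sat (pad L k n) v.
Proof. by elim: n k v => //= n IH k v x; apply: IH. Qed.

(* all Boolean combinations of the formulas in [fs] that decide each of them *)
Fixpoint cells L k n (fs : seq (formula L k)) : seq (formula L k) :=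
  if fs is f :: fs' then
    map (And f) (cells n fs') ++ map (And (Neg f)) (cells n fs')
  else [:: pad L k n].

Lemma qr_cells L k n (fs : seq (formula L k)) :
  all (fun f => qr f <= n) fs -> all (fun f => qr f == n) (cells n fs).
Proof.
elim: fs => [|f fs IH] /=; first by rewrite qr_pad eqxx.
case/andP=> hf /IH {}IH; rewrite all_cat !all_map; apply/andP; split;
  apply: sub_all IH => g /= /eqP ->; by rewrite !maxn0 (maxn_idPr hf).
Qed.

Fixpoint occurs U (x : U) (s : seq U) : Prop :=
  if s is y :: s' then y = x \/ occurs x s' else False.

Lemma occurs_cat U (x : U) s1 s2 :
  occurs x (s1 ++ s2) <-> occurs x s1 \/ occurs x s2.
Proof. elim: s1 => /= [|y s1 IH]; [|rewrite IH]; tauto. Qed.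

Lemma occurs_map U V (f : U -> V) x s : occurs x s -> occurs (f x) (map f s).
Proof. by elim: s => //= y s IH [->|/IH]; [left|right]. Qed.

Lemma occurs_mem (U : eqType) (x : U) s : x \in s -> occurs x s.
Proof.
by elim: s => //= y s IH; rewrite inE => /orP[/eqP ->|/IH]; [left|right].
Qed.

Lemma occurs_allpairs U V W (f : U -> V -> W) x y s t :
  occurs x s -> occurs y t -> occurs (f x y) [seq f x y | x <- s, y <- t].
Proof.
move=> + yt; elim: s => //= z s IH [->|/IH h]; rewrite occurs_cat; last by right.
by left; apply: occurs_map.
Qed.

Lemma occurs_nth U (x0 : U) s i : i < size s -> occurs (nth x0 s i) s.
Proof. by elim: s i => //= y s IH [|i] /=; [left | move/IH; right]. Qed.

Definition agree L (M N : structure L) k (v : k.-tuple M) (w : k.-tuple N)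
    (fs : seq (formula L k)) :=
  forall f, occurs f fs -> (sat f v <-> sat f w).

Lemma cell_unique L (M : structure L) k n (fs : seq (formula L k))
    (v : k.-tuple M) :
  exists! i, i < size (cells n fs) /\ sat (nth Bot (cells n fs) i) v.
Proof.
elim: fs => [|f fs [i [[hi si] ui]]] /=.
  by exists 0; split=> [|[|j] []//]; split=> //; apply: sat_pad.
have nthE g j : sat (nth Bot (map (And g) (cells n fs)) j) v <->
    [/\ j < size (cells n fs), sat g v & sat (nth Bot (cells n fs) j) v].
  case: (ltnP j (size (cells n fs))) => hj.
    by rewrite (nth_map Bot) // sat_And; split=> [[]|[]].
  by rewrite nth_default ?size_map //; split=> [|[]].
set s := size _ in hi ui nthE *.
have satE j : sat (nth Bot (map (And f) (cells n fs) ++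
      map (And (Neg f)) (cells n fs)) j) v <->
    if j < s then sat f v /\ sat (nth Bot (cells n fs) j) v
    else [/\ j - s < s, ~ sat f v & sat (nth Bot (cells n fs) (j - s)) v].
  rewrite nth_cat size_map -/s; case: ifP => hj; rewrite nthE //.
  by split=> [[]|[]].
rewrite size_cat !size_map -/s.
have [hf|hf] := pselect (sat f v).
  exists i; split; first by split; [rewrite ltn_addr | rewrite satE hi].
  move=> j [_]; rewrite satE; case: ifP => [hj [_ sj]|_ []//].
  by apply: ui.
exists (s + i); split.
  by rewrite ltn_add2l; split=> //; rewrite satE ltnNge leq_addr /= addKn.
move=> j [_]; rewrite satE; case: ltnP => [_ []//|hj [h1 _ h2]].
by rewrite (ui _ (conj h1 h2)) subnKC.
Qed.

Lemma agree_cells L (M N : structure L) k n (fs : seq (formula L k))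
    (v : k.-tuple M) (w : k.-tuple N) i :
  sat (nth Bot (cells n fs) i) v -> sat (nth Bot (cells n fs) i) w ->
  agree v w fs.
Proof.
elim: fs i => [|f fs IH] i //=.
have out (g : formula L k) j : sat (nth Bot (map (And g) (cells n fs)) j) v ->
    j < size (cells n fs).
  by case: (ltnP j _) => // hj; rewrite nth_default ?size_map.
have step g : (forall h, sat g v -> sat g w -> h = f -> (sat h v <-> sat h w)) ->
    forall j, sat (nth Bot (map (And g) (cells n fs)) j) v ->
              sat (nth Bot (map (And g) (cells n fs)) j) w ->
              agree v w (f :: fs).
  move=> hg j hv; have hj := out _ _ hv; move: hv.
  rewrite !(nth_map Bot) // !sat_And => -[fv cv] [fw cw] h /= [e|];
    [exact: hg | exact: IH cv cw h].
rewrite nth_cat size_map; case: ifP => _; apply: step => h /= hv hw ->;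
  by split.
Qed.

Definition terms L k : seq (term L k) :=
  map Var (enum 'I_k) ++ map Cst (enum 'I_(nconst L)).

Definition atoms L k : seq (formula L k) :=
  [seq Eq s t | s <- terms L k, t <- terms L k] ++
  [seq Lt s t | s <- terms L k, t <- terms L k] ++
  [seq Prd p t | p <- enum 'I_(npred L), t <- terms L k].

Fixpoint hintikka L n k : seq (formula L k) :=
  cells n (atoms L k ++
    if n is n'.+1 then map (@Exi L k) (hintikka L n' k.+1) else [::]).

Lemma all_qr_atoms L k n : all (fun f => qr f <= n) (atoms L k).
Proof.
have H U V (f : U -> V -> formula L k) s t :
    (forall x y, qr (f x y) = 0) ->
    all (fun g => qr g <= n) [seq f x y | x <- s, y <- t].
  move=> h; elim: s => //= x s IH; rewrite all_cat IH andbT all_map.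
  by elim: t {IH} => //= y t ->; rewrite h.
by rewrite /atoms !all_cat !H.
Qed.

Lemma qr_hintikka L n k : all (fun f => qr f == n) (hintikka L n k).
Proof.
elim: n k => [|n IH] k; apply: qr_cells; rewrite all_cat all_qr_atoms //= all_map.
by apply: sub_all (IH k.+1) => f /= /eqP ->; rewrite !maxn0.
Qed.

Lemma hintikka_unique L (M : structure L) n k (v : k.-tuple M) :
  exists! i, i < size (hintikka L n k) /\ sat (nth Bot (hintikka L n k) i) v.
Proof. by case: n => [|n]; apply: cell_unique. Qed.

Lemma occurs_terms L k (t : term L k) : occurs t (terms L k).
Proof.
by case: t => i; apply/occurs_cat; [left|right];
  apply/occurs_map/occurs_mem; rewrite mem_enum.
Qed.

Lemma hintikka_agree L (M N : structure L) k (phi : formula L k) n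
    (v : k.-tuple M) (w : k.-tuple N) i :
  qr phi <= n ->
  sat (nth Bot (hintikka L n k) i) v -> sat (nth Bot (hintikka L n k) i) w ->
  sat phi v <-> sat phi w.
Proof.
have cellE n' k' (v' : k'.-tuple M) (w' : k'.-tuple N) j :
    sat (nth Bot (hintikka L n' k') j) v' ->
    sat (nth Bot (hintikka L n' k') j) w' ->
    agree v' w' (atoms L k' ++ if n' is m.+1 then
      map (@Exi L k') (hintikka L m k'.+1) else [::]).
  by case: n' => [|n']; apply: agree_cells.
elim: phi n v w i => {k} [k|k s t|k s t|k p t|k a IHa b IHb|k a IHa] n v w i /=.
- by [].
- move=> _ hv hw; apply: (cellE _ _ _ _ _ hv hw (Eq s t)).
  apply/occurs_cat; left; apply/occurs_cat; left.
  by apply: occurs_allpairs; apply: occurs_terms.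
- move=> _ hv hw; apply: (cellE _ _ _ _ _ hv hw (Lt s t)).
  apply/occurs_cat; left; apply/occurs_cat; right; apply/occurs_cat; left.
  by apply: occurs_allpairs; apply: occurs_terms.
- move=> _ hv hw; apply: (cellE _ _ _ _ _ hv hw (Prd p t)).
  apply/occurs_cat; left; apply/occurs_cat; right; apply/occurs_cat; right.
  apply: occurs_allpairs; last exact: occurs_terms.
  by apply: occurs_mem; rewrite mem_enum.
- rewrite geq_max => /andP[qa qb] hv hw.
  by rewrite (IHa _ _ _ _ qa hv hw) (IHb _ _ _ _ qb hv hw).
case: n => // n qa hv hw; have H := cellE _ _ _ _ _ hv hw.
have ex j : j < size (hintikka L n k.+1) ->
    sat (Exi (nth Bot (hintikka L n k.+1) j)) v <->
    sat (Exi (nth Bot (hintikka L n k.+1) j)) w.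
  move=> hj; apply: H; apply/occurs_cat; right.
  by apply: occurs_map; apply: occurs_nth.
split=> h x.
  have [j [[hj sj] _]] := hintikka_unique n [tuple of x :: w].
  have /(ex _ hj).2/sat_Exi[y sy] :
      sat (Exi (nth Bot (hintikka L n k.+1) j)) w by apply/sat_Exi; exists x.
  exact/(IHa _ _ _ _ qa sy sj).
have [j [[hj sj] _]] := hintikka_unique n [tuple of x :: v].
have /(ex _ hj).1/sat_Exi[y sy] :
    sat (Exi (nth Bot (hintikka L n k.+1) j)) v by apply/sat_Exi; exists x.
exact/(IHa _ _ _ _ qa sj sy).
Qed.

Definition shift L k (t : term L k) : term L k.+1 :=
  match t with Var i => Var (lift ord0 i) | Cst c => Cst c end.

Fixpoint translate L L' (p : 'I_(npred L) -> 'I_(npred L')) k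
    (phi : formula L k) :
    forall j, ('I_k -> term L' j) -> ('I_(nconst L) -> term L' j) ->
      formula L' j :=
  let tm k j (s : 'I_k -> term L' j) c (t : term L k) :=
    match t with Var i => s i | Cst d => c d end in
  match phi in formula _ k
    return forall j, ('I_k -> term L' j) -> ('I_(nconst L) -> term L' j) ->
      formula L' j with
  | Bot _ => fun j s c => Bot
  | Eq _ t u => fun j s c => Eq (tm _ j s c t) (tm _ j s c u)
  | Lt _ t u => fun j s c => Lt (tm _ j s c t) (tm _ j s c u)
  | Prd _ q t => fun j s c => Prd (p q) (tm _ j s c t)
  | Imp _ a b => fun j s c => Imp (translate p a s c) (translate p b s c)
  | All _ a => fun j s c =>
      All (translate p a
        (fun i => if unlift ord0 i is Some i' then shift (s i') else Var ord0)
        (fun d => shift (c d)))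
  end.

Lemma qr_translate L L' p k (phi : formula L k) j s c :
  qr (@translate L L' p k phi j s c) = qr phi.
Proof.
by elim: phi j s c => //= [k' a IHa b IHb|k' a IHa] j s c; rewrite ?IHa ?IHb.
Qed.

Lemma eval_shift L (M : structure L) k (v : k.-tuple M) x t :
  eval [tuple of x :: v] (shift t) = eval v t.
Proof. by case: t => //= i; rewrite tnthS. Qed.

Lemma sat_translate L L' (M : structure L) (p : 'I_(npred L) -> 'I_(npred L'))
    (c' : (nconst L').-tuple M) (q' : 'I_(npred L') -> set M)
    (M' := Structure (@lt L M) c' q') k (phi : formula L k) j s c
    (v : k.-tuple M) (w : j.-tuple M) :
  (forall i, q' (p i) = prd i) ->
  (forall i, eval (M := M') w (s i) = tnth v i) ->
  (forall d, eval (M := M') w (c d) = tnth (cst M) d) ->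
  sat (M := M') (translate p phi s c) w <-> sat phi v.
Proof.
move=> hp.
have tmE k' j' (s' : 'I_k' -> term L' j') d' (v' : k'.-tuple M) (w' : j'.-tuple M) t :
    (forall i, eval (M := M') w' (s' i) = tnth v' i) ->
    (forall d, eval (M := M') w' (d' d) = tnth (cst M) d) ->
    eval (M := M') w' (match t with Var i => s' i | Cst d => d' d end) = eval v' t.
  by move=> h1 h2; case: t.
elim: phi j s c v w => {k} [k|k t u|k t u|k q t|k f IHf g IHg|k f IHf] j s c v w
  hs hc /=.
- by [].
- by rewrite !(tmE _ _ _ _ v).
- by rewrite !(tmE _ _ _ _ v).
- by rewrite !(tmE _ _ _ _ v) // hp.
- by rewrite (IHf _ _ _ v) // (IHg _ _ _ v).
have H x : sat (M := M') (translate p f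
      (fun i => if unlift ord0 i is Some i' then shift (s i') else Var ord0)
      (fun d => shift (c d))) [tuple of x :: w] <-> sat f [tuple of x :: v].
  apply: IHf => [i|d]; last by rewrite (@eval_shift L' M').
  by case: unliftP => [i' ->|->]; rewrite ?(@eval_shift L' M') ?tnthS ?hs ?tnth0.
by split=> h x; apply/H.
Qed.

Lemma equivn_expand L (M N : structure L) a b n :
  equivn n (@expand L M 1 [tuple a]) (@expand L N 1 [tuple b]) <->
  forall phi : formula L 1, qr phi <= n ->
    (sat phi ([tuple a] : 1.-tuple M) <-> sat phi ([tuple b] : 1.-tuple N)).
Proof.
have noI0 (U : Type) (i : 'I_0) : U by case: i.
split=> H phi hq.
  pose psi := @translate L (expand_language L 1) id _ phi 0
    (fun=> @Cst (expand_language L 1) 0 (rshift (nconst L) ord0))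
    (fun d => @Cst (expand_language L 1) 0 (lshift 1 d)).
  have E (K : structure L) (e : K) :
      sat (psi : formula (expand_language L 1) 0) ([tuple] : 0.-tuple (@expand L K 1 [tuple e])) <->
      sat phi ([tuple e] : 1.-tuple K).
    apply: sat_translate => // [i|d] /=; last by rewrite tnth_lshift.
    by rewrite tnth_rshift (ord1 i).
  by rewrite -!E; apply: H; rewrite qr_translate.
pose psi := @translate (expand_language L 1) L id _ phi 1 (fun i => noI0 _ i)
  (fun d => match split (d : 'I_(nconst L + 1)) with
            | inl d' => Cst d'
            | inr _ => Var ord0
            end).
have E (K : structure L) (e : K) :
    sat psi ([tuple e] : 1.-tuple K) <->
    sat phi ([tuple] : 0.-tuple (@expand L K 1 [tuple e])).
  case: L K e {H M N a b} phi hq @psi => nc np [K l c q] e phi hq psi.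
  have := @sat_translate (expand_language (Language nc np) 1) (Language nc np)
    (@expand _ (@Structure (Language nc np) K l c q) 1 [tuple e]) id c q _ phi
    1 (fun i => noI0 _ i)
    (fun d => match split (d : 'I_(nc + 1)) with
              | inl d' => @Cst (Language nc np) 1 d'
              | inr _ => @Var (Language nc np) 1 ord0
              end) [tuple] [tuple e].
  apply=> //; first by case.
  move=> d /=; case: (splitP (d : 'I_(nc + 1))) => [d' h|d' h] /=.
    have -> : d = lshift 1 d' by apply: val_inj.
    by rewrite tnth_lshift.
  have -> : d = rshift nc d' by apply: val_inj.
  by rewrite tnth_rshift (ord1 d').
by rewrite -!E; apply: H; rewrite qr_translate.
Qed.

Lemma characteristic_exists L n :
  exists m (taus : m.-tuple (formula L 1)), characteristic n taus.
Proof.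
exists (size (hintikka L n 1)), (in_tuple (hintikka L n 1)).
have nthE i : tnth (in_tuple (hintikka L n 1)) i = nth Bot (hintikka L n 1) i.
  by rewrite (tnth_nth Bot).
have qrE i : qr (tnth (in_tuple (hintikka L n 1)) i) = n.
  rewrite nthE; have := qr_hintikka L n 1.
  by move/(all_nthP Bot)/(_ i (ltn_ord i))/eqP.
split=> // [M a|M N a b].
  have [i [[hi si] ui]] := hintikka_unique n ([tuple a] : 1.-tuple M).
  exists (Ordinal hi); split; first by rewrite nthE.
  by move=> j; rewrite nthE => sj; apply/val_inj/ui; split; first exact: ltn_ord.
rewrite equivn_expand; split=> [H phi hq|H i]; last first.
  by apply: H; rewrite qrE.
have [i [[hi si] _]] := hintikka_unique n ([tuple a] : 1.-tuple M).
apply: (hintikka_agree hq si).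
by have [+ _] := H (Ordinal hi); rewrite nthE; apply.
Qed.

End Existence.

(* Main.v *)
Require Import Defs.
From mathcomp Require Import all_boot.
From mathcomp Require Import boolp classical_sets.

Set Implicit Arguments.
Unset Strict Implicit.
Unset Printing Implicit Defensive.

Local Open Scope classical_set_scope.

(** Focality applied to "y is a leaf and phi(x, y)" shows that all leaves above a
    node t have the same type over t, hence over any tuple of nodes not above t.
    So every open path B defines a limit type over T, that of the leaves above
    t for t far up in B, and in T +_P E the new leaf e_B realises it: replacing
    the new leaves by such leaves of T does not affect the truth of a formula.
    In the induction, the critical case is a witness z in T, for a leaf c replacing
    e_B, that lies above the chosen t.  By variegation take for c the leaf of a
    closed path C with the same spectrum as B over all parameters.
    As T is ideal and monofolic, some s' < c of recurring type is not below z;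
    the same type recurs along B at some s >= t, which moves (c, z) to a pair
    (c1, z1) with c1 a leaf above s and z1 not above s. *)

(** * Agreement of tuples up to a quantifier rank *)

Definition agree_upto L (M N : structure L) n k (u : k.-tuple M)
    (w : k.-tuple N) :=
  forall phi : formula L k, qr phi <= n -> sat phi u <-> sat phi w.

Lemma agree_upto_sym L (M N : structure L) n k (u : k.-tuple M)
    (w : k.-tuple N) : agree_upto n u w -> agree_upto n w u.
Proof. by move=> h phi /h; case. Qed.

Lemma agree_uptoW L (M N : structure L) m n k (u : k.-tuple M)
    (w : k.-tuple N) : m <= n -> agree_upto n u w -> agree_upto m u w.
Proof. by move=> mn h phi hq; apply: h; apply: leq_trans mn. Qed.

(** One round of the Ehrenfeucht-Fraisse game: the rank [n] Hintikka formula of [x :: u],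
    existentially quantified, has rank [n.+1] and so has a witness over [w]. *)
Lemma agree_upto_forth L (M N : structure L) n k (u : k.-tuple M)
    (w : k.-tuple N) :
  agree_upto n.+1 u w ->
  forall x, exists y, agree_upto n [tuple of x :: u] [tuple of y :: w].
Proof.
move=> h x; have [j [[hj sj] _]] := hintikka_unique n [tuple of x :: u].
have /sat_Exi[y sy] : sat (Exi (nth Bot (hintikka L n k.+1) j)) w.
  apply/h; last by apply/sat_Exi; exists x.
  have /(all_nthP Bot)/(_ j hj)/eqP /= -> := qr_hintikka L n k.+1.
  by rewrite !maxn0.
by exists y => phi hq; apply: hintikka_agree hq sj sy.
Qed.

Lemma agree_upto_lt L (M N : structure L) n k (u : k.-tuple M)
    (w : k.-tuple N) (s t : term L k) : agree_upto n u w ->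
  lt (eval u s) (eval u t) <-> lt (eval w s) (eval w t).
Proof. by move/(_ (Lt s t) isT). Qed.

Lemma agree_upto_le L (M N : structure L) n k (u : k.-tuple M)
    (w : k.-tuple N) (s t : term L k) : agree_upto n u w ->
  le (eval u s) (eval u t) <-> le (eval w s) (eval w t).
Proof.
move=> h; have hlt := agree_upto_lt s t h.
have heq : eval u s = eval u t <-> eval w s = eval w t by apply: (h (Eq s t)).
by rewrite /le; tauto.
Qed.

Definition leaf_formula L k (t : term L k) : formula L k :=
  All (Neg (Lt (shift t) (Var ord0))).

Lemma sat_leaf_formula L (M : structure L) k (t : term L k) (v : k.-tuple M) :
  sat (leaf_formula t) v <-> leaf (eval v t).
Proof.
by split=> h y /=; have /= := h y; rewrite eval_shift tnth0.
Qed.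

Lemma agree_upto_leaf L (M N : structure L) n k (u : k.-tuple M)
    (w : k.-tuple N) (t : term L k) : agree_upto n.+1 u w ->
  leaf (eval u t) <-> leaf (eval w t).
Proof. by move=> h; rewrite -!sat_leaf_formula; apply: h. Qed.

Lemma agree_upto_reindex L (M N : structure L) n k l (u : k.-tuple M)
    (w : k.-tuple N) (f : 'I_l -> 'I_k) : agree_upto n u w ->
  agree_upto n [tuple tnth u (f i) | i < l] [tuple tnth w (f i) | i < l].
Proof.
move=> h phi hq.
have E (K : structure L) (x : k.-tuple K) :
    sat (translate id phi (fun i => Var (f i)) (@Cst L k)) x <->
    sat phi [tuple tnth x (f i) | i < l].
  move: (@sat_translate L L K id (cst K) (@prd L K) l phi k
    (fun i => Var (f i)) (@Cst L k) [tuple tnth x (f i) | i < l] x).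
  (* Destructing [K] identifies it with the structure rebuilt from its fields in [sat_translate]. *)
  case: K x => K lt' c p x; apply=> // i.
  by rewrite tnth_mktuple.
by rewrite -!E; apply: h; rewrite qr_translate.
Qed.

(** The variables standing for [p] are replaced by the constants of [expand p], so types over
    parameters become types of tuples. *)
Lemma agree_upto_expand L (M : structure L) n m (p : m.-tuple M) (a b : M) :
  equivn n (@expand _ (expand p) 1 [tuple a]) (@expand _ (expand p) 1 [tuple b]) ->
  agree_upto n [tuple of a :: p] [tuple of b :: p].
Proof.
rewrite equivn_expand => h phi hq.
pose psi : formula (expand_language L m) 1 := @translate L (expand_language L m) id _ phi 1
  (fun i => if unlift ord0 i is Some i' then
     @Cst (expand_language L m) 1 (rshift (nconst L) i') else Var ord0)
  (fun d => @Cst (expand_language L m) 1 (lshift m d)).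
have E (e : M) : sat (M := expand p) psi [tuple e] <-> sat phi [tuple of e :: p].
  apply: sat_translate => // [i|d] /=; last by rewrite tnth_lshift.
  by case: unliftP => [i' ->|->] /=; rewrite ?tnthS ?tnth_rshift.
by rewrite -!E; apply: h; rewrite qr_translate.
Qed.

(** * Order, paths, and gluing along the cone above a node *)

Section Tree.
Variables (L : language) (T : structure L).
Hypothesis hT : is_tree T.
Implicit Types (x y z s t : T) (A B C : set T).

Lemma lt_irr x : ~ lt x x. Proof. by case: hT. Qed.

Lemma lt_tr x y z : lt x y -> lt y z -> lt x z.
Proof. by case: hT => _ _ h _ _; apply: h. Qed.

Lemma le_refl x : le x x. Proof. by right. Qed.

Lemma le_tr x y z : le x y -> le y z -> le x z.
Proof.
move=> [xy|->] // [yz|<-]; last by left.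
by left; apply: lt_tr yz.
Qed.

Lemma le_lt_tr x y z : le x y -> lt y z -> lt x z.
Proof. by move=> [xy|->] //; apply: lt_tr. Qed.

Lemma lt_le_tr x y z : lt x y -> le y z -> lt x z.
Proof. by move=> xy [yz|<-] //; apply: lt_tr yz. Qed.

Lemma downward_total x y z : le x z -> le y z -> le x y \/ le y x.
Proof. by case: hT => _ _ _ h _; apply: h. Qed.

Lemma leaf_le x y : leaf x -> le x y -> x = y.
Proof. by move=> h [/h|]. Qed.

(** Both [x] and [t] would lie below [y], hence be comparable: nodes outside the cone above [t] see
    it only through [t]. *)
Lemma lt_above t x y : ~ le t x -> le t y -> lt x y <-> lt x t.
Proof.
move=> tx ty; split=> [xy|xt]; last exact: lt_le_tr ty.
by case: (downward_total (or_introl xy) ty) => // -[//|e]; case: tx; right.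
Qed.

Lemma path_comparable A : is_path A ->
  forall x y, A x -> A y -> le x y \/ le y x.
Proof. by case=> h _ x y; apply: h. Qed.

Lemma path_maximal A x : is_path A -> (forall y, A y -> le x y \/ le y x) -> A x.
Proof.
move=> [tA mA] h.
apply: (mA (A `|` [set x])) => [y z|y Ay|]; [|by left|by right].
case=> [Ay|->] [Az|->]; [exact: tA| |exact: h|by left; right].
by have [] := h _ Ay; [right|left].
Qed.

Lemma path_downward A x y : is_path A -> A y -> le x y -> A x.
Proof.
move=> pA Ay xy; apply: (path_maximal pA) => z Az.
case: (path_comparable pA Ay Az) => h; first by left; apply: le_tr h.
exact: downward_total xy h.
Qed.

Lemma path_nonempty A : is_path A -> exists x, A x.
Proof.
move=> pA; have [[x] _ _ _ _] := hT; apply: contrapT => h.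
have hA y : ~ A y by move=> Ay; apply: h; exists y.
by apply: (hA x); apply: (path_maximal pA) => y /hA.
Qed.

(** Otherwise [a] would bound [B], belong to it by maximality, and be its greatest element. *)
Lemma open_path_above B a : open_path B -> exists2 t, B t & ~ le t a.
Proof.
move=> [pB gB]; apply: contrapT => h; apply: gB.
have ha y : B y -> le y a.
  by move=> By; apply: contrapT => ya; apply: h; exists y.
by exists a => //; apply: (path_maximal pB) => y /ha; right.
Qed.

Lemma total_bound A n (f : 'I_n -> T) : total_on A (@le L T) -> A !=set0 ->
  (forall i, A (f i)) -> exists2 y, A y & forall i, le (f i) y.
Proof.
move=> tA [x Ax]; elim: n f => [|n IH] f hf; first by exists x => // -[].
have [i|y Ay hy] := IH (fun i => f (lift ord0 i)); first exact: hf.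
have [h|h] := tA _ _ (hf ord0) Ay.
  by exists y => // i; case: (unliftP ord0 i) => [j ->|->].
exists (f ord0) => // i; case: (unliftP ord0 i) => [j ->|->]; last exact: le_refl.
exact: le_tr (hy j) h.
Qed.

(** A correspondence that is the identity off the cone above [t] and follows [r], [r'] inside it.
    Terms rather than indices are used so that constants above [t] are matched too. *)
Definition matched t m (r r' : m.-tuple T) (e e' : T) :=
  (e = e' /\ ~ le t e) \/
  exists s : term L m, [/\ e = eval r s, e' = eval r' s, le t e & le t e'].

Lemma matched_sym t m (r r' : m.-tuple T) e e' :
  matched t r r' e e' -> matched t r' r e' e.
Proof.
by case=> [[<- h]|[s [h1 h2 h3 h4]]]; [left|right; exists s].
Qed.

Lemma matched_le t m (r r' : m.-tuple T) e e' :
  matched t r r' e e' -> le t e -> le t e'.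
Proof. by case=> [[<-]|[s []]]. Qed.

(** With [t] an entry of both tuples, their agreement preserves lying above [t]. *)
Definition anchored t m (r r' : m.-tuple T) :=
  exists j, tnth r j = t /\ tnth r' j = t.

Lemma matched_forth t n m (r r' : m.-tuple T) :
  anchored t r r' -> agree_upto n.+1 r r' ->
  forall x, exists l (q q' : l.-tuple T) y,
    [/\ anchored t q q', agree_upto n q q', matched t q q' x y &
      forall e e', matched t r r' e e' -> matched t q q' e e'].
Proof.
move=> [j [jr jr']] rr' x; have [tx|tx] := pselect (le t x); last first.
  exists m, r, r', x; split=> //; [by exists j|exact: agree_uptoW rr'|by left].
have [y xy] := agree_upto_forth rr' x.
have ty : le t y.
  have := agree_upto_le (Var (lift ord0 j)) (Var ord0) xy.
  by rewrite /= !tnthS !tnth0 jr jr' => -[+ _]; apply.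
exists m.+1, [tuple of x :: r], [tuple of y :: r'], y; split=> //.
- by exists (lift ord0 j); rewrite !tnthS.
- by right; exists (Var ord0); rewrite /= !tnth0.
move=> e e' [h|[s [-> -> h1 h2]]]; [by left|right].
by exists (shift s); rewrite !eval_shift.
Qed.

Lemma matched_eval k t m (r r' : m.-tuple T) (v v' : k.-tuple T) (s : term L k) :
  (forall i, matched t r r' (tnth v i) (tnth v' i)) ->
  matched t r r' (eval v s) (eval v' s).
Proof.
move=> h; case: s => [i|d] /=; first exact: h.
have [td|td] := pselect (le t (tnth (cst T) d)); last by left.
by right; exists (Cst d).
Qed.

(* The part of the tree above [t] meets the rest only through [t], so a move
   there is answered according to [r] and [r'], and a move elsewhere by itself. *)
Lemma sat_glue k (phi : formula L k) n t m (r r' : m.-tuple T)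
    (v v' : k.-tuple T) :
  qr phi <= n -> anchored t r r' -> agree_upto n r r' ->
  (forall i, matched t r r' (tnth v i) (tnth v' i)) ->
  sat phi v <-> sat phi v'.
Proof.
elim: phi n t m r r' v v' => {k} [k|k s u|k s u|k p s|k a IHa b IHb|k a IHa]
  n t m r r' v v' /=.
- by [].
- move=> _ _ rr' h; have := matched_eval u h; have := matched_eval s h.
  (* If only one of the two values lies above [t], the equation fails on both sides. *)
  case=> [[<- ne]|[s' [-> -> le1 le2]]] [[<- nf]|[u' [-> -> le3 le4]]] //.
  + by split=> e; case: ne; rewrite e.
  + by split=> e; case: nf; rewrite -e.
  by have := rr' (Eq s' u'); apply.
- move=> _ _ rr' h; have := matched_eval u h; have := matched_eval s h.
  case=> [[<- ne]|[s' [-> -> le1 le2]]] [[<- nf]|[u' [-> -> le3 le4]]] //.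
  + by rewrite (lt_above ne le3) (lt_above ne le4).
  + split=> e; case: nf; left; [exact: le_lt_tr le1 e|exact: le_lt_tr le2 e].
  exact: agree_upto_lt rr'.
- move=> _ _ rr' h; case: (matched_eval s h) => [[<-]|[s' [-> -> _ _]]] //.
  by have := rr' (Prd p s'); apply.
- rewrite geq_max => /andP[qa qb] ht rr' h.
  by rewrite (IHa _ _ _ _ _ _ _ qa ht rr' h) (IHb _ _ _ _ _ _ _ qb ht rr' h).
case: n => // n qa.
have one (q q' : m.-tuple T) (w w' : k.-tuple T) : anchored t q q' ->
    agree_upto n.+1 q q' -> (forall i, matched t q q' (tnth w i) (tnth w' i)) ->
    sat (All a) w' -> sat (All a) w.
  move=> ht qq' h aw' x.
  have [l [o [o' [y [ho oo' xy ext]]]]] := matched_forth ht qq' x.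
  apply/(IHa _ _ _ _ _ _ _ qa ho oo'); last exact: (aw' y).
  by move=> i; case: (unliftP ord0 i) => [j ->|->]; rewrite ?tnthS ?tnth0 //; apply: ext.
move=> ht rr' h; split; last exact: (one r r').
apply: (one r' r); [by case: ht => j []; exists j|exact: agree_upto_sym|].
by move=> i; apply: matched_sym.
Qed.

End Tree.

(** * Consequences of focality and variegation *)

Section Approximation.
Variables (L : language) (T : structure L).
Hypotheses (hT : is_tree T) (hideal : ideal T) (hmonofolic : monofolic T).
Hypotheses (hwf : well_founded_tree T) (hfocal : focal T) (hvar : variegated T).
Implicit Types (x y z s t c : T) (A B C : set T).

(** A minimal node is least by downward connectedness. *)
Lemma root_exists : exists r : T, forall x, le r x.
Proof.
have [[x0] _ _ _ dc] := hT.
have [r _ hr] := hwf (A := setT) (ex_intro _ x0 I).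
exists r => x; have [y [[yr|->] //]] := dc r x.
by case: (hr y I).
Qed.

Lemma leaves_agree n t c c' : leaf c -> leaf c' -> le t c -> le t c' ->
  agree_upto n [tuple t; c] [tuple t; c'].
Proof.
have one (phi : formula L 2) d d' : leaf d -> leaf d' -> le t d -> le t d' ->
    sat phi [tuple t; d] -> sat phi [tuple t; d'].
  move=> ld ld' td td' h.
  have [|y [ty yd' /sat_And[hy]]] :=
    hfocal (a := t) (phi := And phi (leaf_formula (Var ord_max))) _ td'.
    by exists d => //; apply/sat_And; split=> //; apply/sat_leaf_formula.
  rewrite sat_leaf_formula => /= ly.
  (* Comparable leaves are equal. *)
  have <- // : y = d' by case: yd' => [/ly|/ld'|].
by move=> lc lc' tc tc' phi _; split; apply: one.
Qed.

(** All leaves lie above the root, where focality applies; hence a single [U] suits every new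
    leaf. *)
Lemma leaves_prd (p : 'I_(npred L)) c c' :
  leaf c -> leaf c' -> prd p c -> prd p c'.
Proof.
have [r hr] := root_exists => lc lc'.
have h : agree_upto 0 _ _ := leaves_agree lc lc' (hr c) (hr c').
by have [+ _] := h (Prd p (Var ord_max)) isT.
Qed.

Lemma open_path_no_leaf B x : open_path B -> B x -> ~ leaf x.
Proof.
move=> [pB gB] Bx lx; apply: gB; exists x => // y By.
by case: (path_comparable pB Bx By) => // -[/lx|->]; [|exact: le_refl].
Qed.

(** There are finitely many types, so far enough up $C^-$ only types in the spectrum of [C] occur.
    These are in the spectrum of [B] too, so they recur cofinally in [B]. *)
Lemma open_path_approx B n m (p : m.-tuple T) : open_path B ->
  exists c, [/\ leaf c, exists q, lt q c & forall q, lt q c ->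
    exists s', [/\ le q s', lt s' c & forall b, B b ->
      exists s, [/\ B s, le b s &
        agree_upto n [tuple of s' :: p] [tuple of s :: p]]]].
Proof.
move=> oB; have [pB gB] := oB.
have [l [taus ch]] := characteristic_exists (expand_language L m) n.
have [C [pC [c Cc gc]] spC] := hvar oB (a := p) ch erefl.
have [_ uni eqv] := ch.
have lc : leaf c.
  move=> y cy; have /gc yc : C y.
    by apply: (path_maximal pC) => z /gc zc; right; left; apply: le_lt_tr cy.
  by apply: (@lt_irr _ _ hT c); apply: lt_le_tr cy yc.
have minC q : lt q c <-> minus_leaf C q.
  split=> [qc|[/gc[//|->]]] //; split; last by move/(_ c).
  by apply: path_downward Cc _ => //; left.
(* Take a common lower bound of [c] and a node [b] of [B]. It is not [c], or else the leaf [c] would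
   equal [b], while [B] continues beyond [b]. *)
have [q0 q0c] : exists q, lt q c.
  have [b Bb] := path_nonempty hT pB.
  have [b' Bb' b'b] := open_path_above b oB.
  have [_ _ _ _ /(_ c b)[x [[xc|->] xb]]] := hT; first by exists x.
  have cb := leaf_le lc xb; rewrite cb in lc.
  case: b'b; case: (path_comparable pB Bb' Bb) => // /(leaf_le lc) ->.
  exact: le_refl.
exists c; split=> //; first by exists q0.
move=> q qc.
(* From [f i] on, a type [i] outside the spectrum no longer occurs in $C^-$; for the other types [q]
   is a default. *)
have /choice[f hf] (i : 'I_l) : exists z : T, minus_leaf C z /\
    (~ spectrum (T := expand p) taus C i -> forall y, minus_leaf C y -> le z y ->
      ~ sat (M := expand p) (tnth taus i) [tuple y]).
  have [hi|hi] := pselect (spectrum (T := expand p) taus C i).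
    by exists q; split=> //; exact/minC.
  apply: contrapT => no; apply: hi => x Cx; apply: contrapT => nox.
  apply: no; exists x; split=> // _ y Cy xy sy; apply: nox.
  by exists y.
have totC : total_on (minus_leaf C) (@le L T).
  by move=> x y [Cx _] [Cy _]; apply: (path_comparable pC Cx Cy).
have [|i|y0 Cy0 hy0] := total_bound hT (f := f) totC.
- by exists q; apply/minC.
- by case: (hf i).
have [y [Cy qy fy]] : exists y, [/\ minus_leaf C y, le q y & forall i, le (f i) y].
  have Cq : minus_leaf C q by apply/minC.
  case: (totC _ _ Cq Cy0) => h; first by exists y0.
  by exists q; split=> // [|i]; [exact: le_refl|exact: le_tr h].
have [i [si ui]] := uni (expand p) y.
have hi : spectrum (T := expand p) taus C i.
  by apply: contrapT => /(hf i).2/(_ y Cy (fy i)); apply.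
exists y; split=> //; first exact/minC.
move=> b Bb; rewrite spC in hi.
have [|s [[Bs _] ss] bs] := hi b; first by split=> //; exact: open_path_no_leaf Bb.
exists s; split=> //; apply: agree_upto_expand; apply/eqv => j.
have [k [sk uk]] := uni (expand p) s.
have ks : k = i by apply: uk.
by split=> [/ui <-|/uk <-] //; rewrite ks.
Qed.

(** Some [s'] below a leaf [c] agrees over [t] with a node of [B] above [t]; rank 0 suffices to
    place [s'] above [t]. *)
Lemma leaf_above B t : open_path B -> B t -> exists2 c, leaf c & le t c.
Proof.
move=> oB Bt; have [c [lc [q qc] /(_ q qc)]] := open_path_approx 0 [tuple t] oB.
move=> [s' [_ s'c /(_ t Bt)[s [_ ts]]]].
move/(agree_upto_le (Var (lift ord0 ord0)) (Var ord0)).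
rewrite /= !tnthS !tnth0 => -[_ /(_ ts) ts'].
by exists c => //; apply: le_tr ts' _; rewrite //; left.
Qed.

(** * Replacing new leaves by leaves of [T] *)

Variable U : set 'I_(npred L).
Hypothesis hU : forall c, leaf c -> forall p, U p <-> prd p c.

Notation T' := (add_leaves (@open_path L T) U).
Notation new := {A : set T | open_path A}.

(** The node [t] is so far up the path that its cone contains the substitute for [e], but no other
    entry and no constant. *)
Definition threshold k (v : k.-tuple T') (rho : T' -> T) (e : new) t :=
  [/\ sval e t, le t (rho (inr e)), leaf (rho (inr e)),
      forall j, tnth v j <> inr e -> ~ le (inl t : T') (tnth v j)
    & forall d, ~ le t (tnth (cst T) d)].

(** Only new leaves occurring in [v] are constrained; the values at the others are free. *)
Definition approximates k (v : k.-tuple T') (rho : T' -> T) :=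
  (forall x, rho (inl x) = x) /\
  forall i e, tnth v i = inr e -> exists t, threshold v rho e t.

Lemma le_inl t x : le (inl t : T') (inl x) <-> le t x.
Proof.
by split=> [[h|[->]]|[h|->]]; [left|right|left|right].
Qed.

Lemma le_inr t (e : new) : le (inl t : T') (inr e) <-> sval e t.
Proof. by split=> [[]|] //; left. Qed.

Lemma new_eq (e e' : new) : (sval e `<=` sval e')%classic -> e = e'.
Proof.
case: e e' => [B [pB gB]] [B' [pB' gB']] /= BB'.
have E : B = B'.
  by apply/seteqP; split=> //; apply: (pB.2 B') => //; exact: pB'.1.
by case: _ / E in pB' gB' BB' *; congr exist; apply: Prop_irrelevance.
Qed.

Lemma new_separate (e : new) (y : T') : y <> inr e ->
  exists t, sval e t /\ ~ le (inl t : T') y.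
Proof.
case: y => [a _|e' ee'].
  by have [t Bt ta] := open_path_above a (svalP e); exists t; rewrite le_inl.
apply: contrapT => h; apply: ee'; congr inr; apply/esym/new_eq => t et.
by apply: contrapT => e't; apply: h; exists t; rewrite le_inr.
Qed.

Lemma approximates_exists k (v : k.-tuple T') : exists rho, approximates v rho.
Proof.
have ex (e : new) : exists c t, [/\ sval e t, le t c, leaf c,
    forall j, tnth v j <> inr e -> ~ le (inl t : T') (tnth v j)
    & forall d, ~ le t (tnth (cst T) d)].
  have [pB _] := svalP e; have ne := path_nonempty hT pB.
  have tot : total_on (sval e) (@le L T) by case: pB.
  (* The path has left entry [j] behind at [f j]; if that entry is [e] itself, any node of the path
     serves. *)
  have /choice[f hf] j : exists t, sval e t /\
      (tnth v j <> inr e -> ~ le (inl t : T') (tnth v j)).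
    have [->|/new_separate[t [et ht]]] := pselect (tnth v j = inr e).
      by have [t et] := ne; exists t.
    by exists t.
  have /choice[g hg] d : exists t, sval e t /\ ~ le t (tnth (cst T) d).
    by have [t] := open_path_above (tnth (cst T) d) (svalP e); exists t.
  have [i|t1 et1 h1] := total_bound hT (f := f) tot ne; first by case: (hf i).
  have [i|t2 et2 h2] := total_bound hT (f := g) tot ne; first by case: (hg i).
  have [t [et h1' h2']] : exists t, [/\ sval e t, le t1 t & le t2 t].
    by case: (tot _ _ et1 et2) => h; [exists t2|exists t1]; split=> //; apply: le_refl.
  have [c lc tc] := leaf_above (svalP e) et.
  exists c, t; split=> // [j /((hf j).2) h tv|d td].
    apply: h; case: (tnth v j) tv => [a|e'].
      by rewrite !le_inl; apply: le_tr => //; apply: le_tr h1'.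
    rewrite !le_inr => e't; apply: path_downward (svalP e').1 e't _ => //.
    exact: le_tr h1'.
  apply: (hg d).2; apply: le_tr td => //; exact: le_tr h2'.
have [h hh] := choice ex.
exists (fun x : T + new => match x with inl a => a | inr e => h e end).
by split=> // i e _; apply: hh.
Qed.

Lemma thresholdW k (v : k.-tuple T') rho rho' e t :
  threshold v rho e t -> leaf (rho' (inr e)) -> le t (rho' (inr e)) ->
  threshold v rho' e t.
Proof. by case. Qed.

(** If another new leaf had its substitute above [t], the two thresholds would be comparable below
    it, so one path would contain the other's threshold. *)
Lemma threshold_outside k (v : k.-tuple T') rho e i t :
  approximates v rho -> threshold v rho e t ->
  forall j, tnth v i = inr e -> tnth v j <> inr e -> ~ le t (rho (tnth v j)).
Proof.
move=> [rl ra] [et tc _ ht _] j vi vj; have := ht j vj.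
case E : (tnth v j) => [a|e']; first by rewrite le_inl rl.
rewrite le_inr => e't te'; have [t' [e't' t'c _ /(_ i) + _]] := ra _ _ E.
rewrite vi le_inr => et'; case: (downward_total hT te' t'c) => h.
  by apply: e't; apply: path_downward (svalP e').1 e't' h.
apply: et'; last exact: path_downward (svalP e).1 et h.
by move=> [ee']; apply: vj; rewrite E ee'.
Qed.

Lemma threshold_disjoint k (v : k.-tuple T') rho i e t i' e' t' :
  tnth v i = inr e -> tnth v i' = inr e' -> e <> e' ->
  threshold v rho e t -> threshold v rho e' t' ->
  forall x, le t x -> le t' x -> False.
Proof.
move=> vi vi' ee' [et _ _ h _] [et' _ _ h' _] x tx t'x.
have {}h : ~ sval e' t.
  by rewrite -le_inr -vi'; apply: h; rewrite vi' => -[/esym].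
have {}h' : ~ sval e t' by rewrite -le_inr -vi; apply: h'; rewrite vi => -[].
case: (downward_total hT tx t'x) => tt'.
  by apply: h; apply: path_downward (svalP e').1 et' tt'.
by apply: h'; apply: path_downward (svalP e).1 et tt'.
Qed.

(** Both substitutes for [e] lie above the lower of the two thresholds and agree over it by
    focality; [sat_glue] does the rest. *)
Lemma sat_change_leaf k (phi : formula L k) (v : k.-tuple T') rho rho' (e : new) :
  approximates v rho -> approximates v rho' ->
  (forall x : T', x <> inr e -> rho x = rho' x) ->
  sat phi [tuple of map rho v] <-> sat phi [tuple of map rho' v].
Proof.
move=> hr hr' rr'.
have [[i vi]|no] := pselect (exists i, tnth v i = inr e); last first.
  suff -> : [tuple of map rho v] = [tuple of map rho' v] by [].
  apply: eq_from_tnth => i; rewrite !tnth_map; apply: rr' => vi.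
  by apply: no; exists i.
have [t ht ht'] : exists2 t, threshold v rho e t & threshold v rho' e t.
  have [t1 h1] := hr.2 _ _ vi; have [t2 h2] := hr'.2 _ _ vi.
  have [[e1 l1 c1 _ _] [e2 l2 c2 _ _]] := (h1, h2).
  case: (path_comparable (svalP e).1 e1 e2) => h.
    by exists t1 => //; apply: thresholdW h1 c2 _; apply: le_tr l2.
  by exists t2 => //; apply: thresholdW h2 c1 _; apply: le_tr l1.
have [[_ tc lc _ _] [_ tc' lc' _ _]] := (ht, ht').
have cc' : agree_upto (qr phi) _ _ := leaves_agree lc lc' tc tc'.
apply: (sat_glue (t := t) hT (leqnn _) _ cc') => [|j]; first by exists ord0.
 rewrite !tnth_map.
have [->|vj] := pselect (tnth v j = inr e); first by right; exists (Var ord_max).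
by left; split; [exact: rr'|exact: threshold_outside ht _ vi vj].
Qed.

Lemma sat_approximates k (phi : formula L k) (v : k.-tuple T') rho rho' :
  approximates v rho -> approximates v rho' ->
  sat phi [tuple of map rho v] <-> sat phi [tuple of map rho' v].
Proof.
move=> hr hr'.
(* replace the leaves one at a time *)
pose mix (s : seq T') (x : T') := if `[< occurs x s >] then rho' x else rho x.
have hmix (s : seq T') : approximates v (mix s).
  split=> [x|i e vi]; first by rewrite /mix; case: ifP; rewrite ?hr.1 ?hr'.1.
  rewrite /threshold /mix; case: ifP => _; [exact: hr'.2 vi|exact: hr.2 vi].
have step (s : seq T') : sat phi [tuple of map rho v] <-> sat phi [tuple of map (mix s) v].
  elim: s => [|x s ->].
    suff -> : [tuple of map rho v] = [tuple of map (mix [::]) v] by [].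
    by apply: eq_from_tnth => i; rewrite !tnth_map /mix asboolF.
  case: x => [a|e].
    suff -> : [tuple of map (mix s) v] = [tuple of map (mix (inl a :: s)) v] by [].
    apply: eq_from_tnth => i; rewrite !tnth_map.
    case E : (tnth v i) => [b|e]; first by rewrite !(hmix _).1.
    rewrite /mix; congr (if _ then _ else _).
    by apply/asboolP/asboolP => /=; [right|case].
  apply: (sat_change_leaf phi (e := e)) => // x xe; rewrite /mix.
  congr (if _ then _ else _); apply/asboolP/asboolP => /=; first by right.
  by case=> // /esym.
rewrite (step v).
suff -> : [tuple of map rho' v] = [tuple of map (mix v) v] by [].
apply: eq_from_tnth => i; rewrite !tnth_map /mix ifT //; apply/asboolP.
by rewrite (tnth_nth (tnth v i)); apply: occurs_nth; rewrite size_tuple.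
Qed.

(** * Extending and updating approximations *)

Lemma map_cons_tuple k (rho : T' -> T) (x : T') (v : k.-tuple T') :
  [tuple of map rho [tuple of x :: v]] = [tuple of rho x :: [tuple of map rho v]].
Proof. exact: val_inj. Qed.

Lemma threshold_cons k (v : k.-tuple T') rho (e : new) t (x : T') :
  threshold v rho e t -> (x <> inr e -> ~ le (inl t : T') x) ->
  threshold [tuple of x :: v] rho e t.
Proof.
move=> [h1 h2 h3 h4 h5] hx; split=> // j.
by case: (unliftP ord0 j) => [j' ->|->]; rewrite ?tnthS ?tnth0 //; apply: h4.
Qed.

Lemma approximates_behead k (v : k.-tuple T') rho (x : T') :
  approximates [tuple of x :: v] rho -> approximates v rho.
Proof.
move=> [h1 h2]; split=> // i e vi; have [|t [k1 k2 k3 k4 k5]] := h2 (lift ord0 i) e.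
  by rewrite tnthS.
by exists t; split=> // j vj; have := k4 (lift ord0 j); rewrite tnthS; apply.
Qed.

Lemma approximates_dup k (v : k.-tuple T') rho i :
  approximates v rho -> approximates [tuple of tnth v i :: v] rho.
Proof.
move=> [h1 h2]; split=> // j e vj.
have [j' vj'] : exists j', tnth v j' = inr e.
  move: vj; case: (unliftP ord0 j) => [j' ->|->]; first by rewrite tnthS; exists j'.
  by rewrite tnth0; exists i.
have [t ht] := h2 _ _ vj'; exists t; apply: threshold_cons => //.
by case: ht => _ _ _ + _; apply.
Qed.

Lemma approximates_inl k (v : k.-tuple T') rho z :
  (forall x, rho (inl x) = x) ->
  (forall i e, tnth v i = inr e -> exists2 t, threshold v rho e t & ~ le t z) ->
  approximates [tuple of (inl z : T') :: v] rho.
Proof.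
move=> h1 h2; split=> // j e.
case: (unliftP ord0 j) => [i ->|->]; rewrite ?tnthS ?tnth0 // => /h2[t ht tz].
by exists t; apply: threshold_cons => // _; rewrite le_inl.
Qed.

Definition update (rho : T' -> T) (e : new) c (x : T') : T :=
  if `[< x = inr e >] then c else rho x.

Lemma update_eq rho e c : update rho e c (inr e) = c.
Proof. by rewrite /update asboolT. Qed.

Lemma update_neq rho (e : new) c (x : T') :
  x <> inr e -> update rho e c x = rho x.
Proof. by move=> h; rewrite /update asboolF. Qed.

Lemma threshold_update_eq k (v : k.-tuple T') rho e t s c :
  threshold v rho e t -> sval e s -> le t s -> leaf c -> le s c ->
  threshold v (update rho e c) e s.
Proof.
move=> [h1 h2 h3 h4 h5] es ts lc sc; split; rewrite ?update_eq //; last first.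
  by move=> d sd; apply: (h5 d); apply: le_tr sd.
move=> j vj; have := h4 j vj; case: (tnth v j) => [a|e'].
  by rewrite !le_inl => ta sa; apply: ta; apply: le_tr sa.
by rewrite !le_inr => ta sa; apply: ta; apply: path_downward (svalP e').1 sa ts.
Qed.

Lemma threshold_update_neq k (v : k.-tuple T') rho e c e' t :
  e' <> e -> threshold v rho e' t -> threshold v (update rho e c) e' t.
Proof.
move=> ne [h1 h2 h3 h4 h5]; have ne' : inr e' <> inr e :> T' by case.
by split; rewrite ?update_neq.
Qed.

Lemma approximates_update k (v : k.-tuple T') rho e c t :
  approximates v rho -> threshold v (update rho e c) e t ->
  approximates v (update rho e c).
Proof.
move=> [h1 h2] ht; split=> [x|i e' vi]; first by rewrite update_neq.
have [->|ne] := pselect (e' = e); first by exists t.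
by have [t' ht'] := h2 _ _ vi; exists t'; apply: threshold_update_neq.
Qed.

(** * Comparing truth in [T'] and [T]: atoms, then quantifiers *)

Lemma threshold_eval k (v : k.-tuple T') rho e t (s : term L k) :
  threshold v rho e t -> eval v s <> inr e -> ~ le (inl t : T') (eval v s).
Proof.
by move=> [_ _ _ h1 h2]; case: s => [i|d] /=; [exact: h1|rewrite tnth_map le_inl].
Qed.

Lemma eval_approximates k (v : k.-tuple T') rho (s : term L k) :
  approximates v rho -> eval [tuple of map rho v] s = rho (eval v s).
Proof. by move=> [h _]; case: s => [i|d] /=; rewrite tnth_map ?h. Qed.

Lemma eval_inr k (v : k.-tuple T') (s : term L k) e :
  eval v s = inr e -> exists2 i, s = Var i & tnth v i = inr e.
Proof. by case: s => [i|d] /=; [exists i|rewrite tnth_map]. Qed.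

Lemma eq_approximates k (v : k.-tuple T') rho (s u : term L k) :
  approximates v rho -> eval v s = eval v u <-> rho (eval v s) = rho (eval v u).
Proof.
move=> hr; split=> [-> //|].
have one (s' u' : term L k) e : eval v s' = inr e -> eval v u' <> inr e ->
    rho (eval v s') <> rho (eval v u').
  move=> es; have [i _ vi] := eval_inr es; have [t ht] := hr.2 _ _ vi.
  case: u' => [j|d] /= vj ee; have [_ tc _ _ hd] := ht; rewrite es in ee.
    by apply: (threshold_outside hr ht vi vj); rewrite -ee.
  by apply: (hd d); move: tc; rewrite ee tnth_map hr.1.
case Es : (eval v s) => [a|e]; case Eu : (eval v u) => [b|e'].
- by rewrite !hr.1 => ->.
- by move=> h; case: (one u s e' Eu) => //; rewrite ?Es ?Eu.
- by move=> h; case: (one s u e Es) => //; rewrite ?Es ?Eu.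
move=> h; apply: contrapT => ne; case: (one u s e' Eu) => //; rewrite ?Es ?Eu //.
Qed.

(** For a node [a] not above the threshold [t] of [e], both relations with [e] and with its
    substitute reduce to [lt a t]. *)
Lemma lt_approximates k (v : k.-tuple T') rho (s u : term L k) :
  approximates v rho ->
  lt (eval v s) (eval v u) <-> lt (rho (eval v s)) (rho (eval v u)).
Proof.
move=> hr; case Es : (eval v s) => [a|e]; last first.
  have [i _ vi] := eval_inr Es; have [t [_ _ lc _ _]] := hr.2 _ _ vi.
  by split=> // /lc.
case Eu : (eval v u) => [b|e]; first by rewrite !hr.1.
have [i _ vi] := eval_inr Eu; have [t ht] := hr.2 _ _ vi.
have ta : ~ le t a.
  by rewrite -le_inl -Es; apply: (threshold_eval ht); rewrite Es.
have [et tc _ _ _] := ht; rewrite hr.1 (lt_above hT ta tc) /=; split=> [ea|h].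
  by case: (path_comparable (svalP e).1 et ea) => // -[|e']; [|case: ta; right].
by apply: path_downward (svalP e).1 et _ => //; left.
Qed.

(** This is the hard direction for [All]: a counterexample in [T] comes from one in [T'], at the
    cost of changing the approximation. *)
Lemma counterexample_lift k (a : formula L k.+1) (v : k.-tuple T') rho z :
  approximates v rho -> ~ sat a [tuple of z :: [tuple of map rho v]] ->
  exists (x : T') (rho' : T' -> T), approximates [tuple of x :: v] rho' /\
    ~ sat a [tuple of map rho' [tuple of x :: v]].
Proof.
move=> hr nz.
have [fine|] := pselect (forall i e, tnth v i = inr e ->
    exists2 t, threshold v rho e t & ~ le t z).
  exists (inl z), rho; split; first exact: approximates_inl hr.1 fine.
  by rewrite map_cons_tuple hr.1.
move=> bad.
have [i [e [t [vi ht tz]]]] : exists i e t,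
    [/\ tnth v i = inr e, threshold v rho e t & le t z].
  apply: contrapT => no; apply: bad => i e vi.
  have [t ht] := hr.2 _ _ vi; exists t => // tz.
  by apply: no; exists i, e, t.
have [et tc lc _ _] := ht.
(* Of the three extra ranks, two pay for moving [c0] and [z0], and one for saying that [c1] is a
   leaf. *)
have [c0 [lc0 [q0 q0c] P]] := open_path_approx (qr a).+3
  [tuple of t :: [tuple of map rho v]] (svalP e).
have tc0 : le t c0.
  have [s' [_ s'c /(_ t et)[s [_ ts]]]] := P q0 q0c.
  move/(agree_upto_le (Var (lift ord0 ord0)) (Var ord0)).
  rewrite /= !tnthS !tnth0 => -[_ /(_ ts) ts'].
  by apply: le_tr ts' _ => //; left.
have ht0 := threshold_update_eq ht et (le_refl t) lc0 tc0.
have hr0 := approximates_update hr ht0.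
have cc0 : agree_upto (qr a).+1 _ _ := leaves_agree lc lc0 tc tc0.
(* Exchanging the old substitute for [c0] moves [z] to [z0]. *)
have [|l [q [q' [z0 [hq qq' zz0 ext]]]]] := matched_forth (t := t) _ cc0 z.
  by exists ord0.
have nz0 : ~ sat a [tuple of z0 :: [tuple of map (update rho e c0) v]].
  suff E : sat a [tuple of z :: [tuple of map rho v]] <->
      sat a [tuple of z0 :: [tuple of map (update rho e c0) v]] by rewrite -E.
  apply: (sat_glue hT (leqnn _) hq qq') => j.
  case: (unliftP ord0 j) => [j' ->|->]; rewrite ?tnthS ?tnth0 // !tnth_map.
  apply: ext; have [->|vj] := pselect (tnth v j' = inr e).
    by rewrite update_eq; right; exists (Var ord_max).
  by rewrite update_neq //; left; split=> //; apply: threshold_outside ht _ vi vj.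
have tz0 : le t z0 := matched_le zz0 tz.
(* If [z0] is the substitute [c0], the new leaf [e] itself is the counterexample. *)
have [zc|zc] := pselect (z0 = c0).
  exists (tnth v i), (update rho e c0); split; first exact: approximates_dup.
  by move: nz0; rewrite map_cons_tuple vi update_eq zc.
(* Monofolicity gives [q1] not strictly below [z0]; if it equals [z0], idealness gives a node
   strictly between it and [c0]. *)
have [q1 q1c q1z] : exists2 q1, lt q1 c0 & ~ le q1 z0.
  have [q1 q1c q1z] : exists2 q1, lt q1 c0 & ~ lt q1 z0.
    apply: contrapT => no; apply: zc; apply: (hmonofolic lc0) => y yc.
    by apply: contrapT => yz; apply: no; exists y.
  have [E|ne] := pselect (q1 = z0); last by exists q1 => // -[].
  have [q2 q12 q2c] := hideal lc0 q1c; exists q2 => //; rewrite -E => h.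
  by apply: (@lt_irr _ _ hT q1); apply: lt_le_tr h.
have [s' [qs' s'c /(_ t et)[s [es ts ss']]]] := P q1 q1c.
have [c1 cc1] := agree_upto_forth ss' c0.
have [z1 zz1] := agree_upto_forth cc1 z0.
(* [V0] to [V3] name [z0], [c0], [s'], [t] on one side and [z1], [c1], [s], [t] on the other. *)
pose V0 := Var ord0 : term L k.+4.
pose V1 := Var (lift ord0 ord0) : term L k.+4.
pose V2 := Var (lift ord0 (lift ord0 ord0)) : term L k.+4.
pose V3 := Var (lift ord0 (lift ord0 (lift ord0 ord0))) : term L k.+4.
have lc1 : leaf c1.
  by have := agree_upto_leaf V1 zz1; rewrite /= !tnthS !tnth0 => -[/(_ lc0)].
have sc1 : le s c1.
  have := agree_upto_le V2 V1 zz1; rewrite /= !tnthS !tnth0 => -[+ _]; apply.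
  by left.
have sz1 : ~ le s z1.
  have := agree_upto_le V2 V0 zz1; rewrite /= !tnthS !tnth0 => -[_ h] /h s'z.
  by apply: q1z; apply: le_tr s'z.
have tz1 : le t z1.
  by have := agree_upto_le V3 V0 zz1; rewrite /= !tnthS !tnth0 => -[+ _]; apply.
have ht1 := threshold_update_eq ht es ts lc1 sc1.
exists (inl z1), (update rho e c1); split.
  apply: approximates_inl => [x|i' e' vi']; first by rewrite update_neq // hr.1.
  (* The threshold of [e] rises to [s], which is not below [z1]; the other thresholds have cones
     disjoint from that of [t], which contains [z1]. *)
  have [->|ne] := pselect (e' = e); first by exists s.
  have [t' ht'] := hr.2 _ _ vi'; exists t'; first exact: threshold_update_neq.
  by apply: (threshold_disjoint vi vi' _ ht ht' tz1) => /esym.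
rewrite map_cons_tuple update_neq // hr.1.
(* The reindexing drops [s] and [t] and puts the substitute at each occurrence of [e] in [v]. *)
pose f (j : 'I_k.+1) : 'I_k.+4 :=
  if unlift ord0 j is Some j' then
    if `[< tnth v j' = inr e >] then lift ord0 ord0
    else lift ord0 (lift ord0 (lift ord0 (lift ord0 j')))
  else ord0.
have fE y d u :
    [tuple tnth [tuple of y :: [tuple of d :: [tuple of u ::
       [tuple of t :: [tuple of map rho v]]]]] (f j) | j < k.+1] =
    [tuple of y :: [tuple of map (update rho e d) v]].
  apply: eq_from_tnth => j; rewrite tnth_mktuple /f.
  case: (unliftP ord0 j) => [j' ->|->]; rewrite ?tnthS ?tnth0 // tnth_map /update.
  by case: ifP => _; rewrite !tnthS ?tnth0 ?tnth_map.
have := agree_upto_reindex f zz1; rewrite !fE => /(_ a (leqnSn _)).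
by move=> h /h.
Qed.

Lemma sat_approximation k (phi : formula L k) (v : k.-tuple T') rho :
  approximates v rho -> sat phi v <-> sat phi [tuple of map rho v].
Proof.
elim: phi v rho => {k} [k|k s u|k s u|k p s|k a IHa b IHb|k a IHa] v rho hr /=.
- by [].
- by rewrite !eval_approximates //; apply: eq_approximates.
- by rewrite !eval_approximates //; apply: lt_approximates.
- rewrite eval_approximates //; case E : (eval v s) => [a|e] /=; first by rewrite hr.1.
  have [i _ vi] := eval_inr E; have [t [_ _ lc _ _]] := hr.2 _ _ vi.
  exact: hU.
- by rewrite (IHa _ rho) // (IHb _ rho).
split=> [h z|h x].
  apply: contrapT => /(counterexample_lift hr)[x [rho' [hr']]].
  by rewrite -IHa.
(* This [rho'] may differ from [rho] on [v], which [sat_approximates] makes harmless. *)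
have [rho' hr'] := approximates_exists [tuple of x :: v].
rewrite (IHa _ rho') // map_cons_tuple.
by apply: ((sat_approximates (All a) hr (approximates_behead hr')).1 h).
Qed.

(** An approximation fixes old nodes, so on tuples from [T] the replacement changes nothing. *)
Lemma add_leaves_elementary : elementary_embedding (inl : T -> T').
Proof.
move=> k phi v; have [rho hr] := approximates_exists [tuple of map (inl : T -> T') v].
rewrite (sat_approximation phi hr).
suff -> : [tuple of map rho [tuple of map (inl : T -> T') v]] = v by [].
by apply: eq_from_tnth => i; rewrite !tnth_map hr.1.
Qed.

End Approximation.

(** * The extended tree is a bounded tree *)

Section AddLeaves.
Variables (L : language) (T : structure L) (U : set 'I_(npred L)).
Hypothesis hT : is_tree T.

Notation T' := (add_leaves (@open_path L T) U).

Lemma add_leaves_tree : is_tree T'.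
Proof.
have [[x0] _ _ dt dc] := hT; split.
- exact: (inhabits (inl x0 : T')).
- by case=> [x|e] //=; apply: lt_irr.
- move=> [x|e] [y|e'] [z|e''] //=; first exact: lt_tr.
  by move=> xy e''y; apply: path_downward (svalP e'').1 e''y _ => //; left.
- have tot_inr (e : {A : set T | open_path A}) (x y : T') :
      le x (inr e : T') -> le y (inr e : T') -> le x y \/ le y x.
    move=> [xe|->] [ye|->]; [|by left; left|by right; left|by left; right].
    case: x y xe ye => [x|//] [y|//] xe ye; rewrite !le_inl.
    exact: (path_comparable (svalP e).1 xe ye).
  case=> [t|e] x y; last exact: tot_inr.
  case: x y => [x|e] [y|e'] /=; try (by move=> []); try by move=> _ [].
  by rewrite !le_inl; apply: downward_total.
have ne (s : T') : exists x : T, le (inl x : T') s.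
  case: s => [s|e]; first by exists s; right.
  by have [x ex] := path_nonempty hT (svalP e).1; exists x; left.
move=> s t; have [[x xs] [y yt]] := (ne s, ne t).
have [z [zx zy]] := dc x y; exists (inl z).
have below (u w : T) (r : T') : le u w -> le (inl w : T') r -> le (inl u : T') r.
  case: r => [r|e]; rewrite ?le_inl ?le_inr; first exact: le_tr.
  by move=> uw ew; apply: path_downward (svalP e).1 ew uw.
by split; [apply: below xs|apply: below yt].
Qed.

(** A new leaf on a path is its greatest element. A path without a greatest element thus consists of
    old nodes and is an open path of [T], to which its new leaf could be adjoined. *)
Lemma add_leaves_bounded : bounded_tree T'.
Proof.
move=> A [tA mA]; apply: contrapT => ng.
have noinr e : ~ A (inr e).
  move=> Ae; apply: ng; exists (inr e) => // y Ay.
  by case: (tA _ _ Ay Ae) => // -[//|<-]; right.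
pose B : set T := [set x | A (inl x)].
have pB : is_path B.
  split=> [x y Bx By|C tC BC x Cx].
    by have := tA _ _ Bx By; rewrite !le_inl.
  apply: (mA [set y | if y is inl z then C z else False]) => [[y|//] [z|//] Cy Cz|[y|e] Ay|] //.
  - by rewrite !le_inl; apply: tC.
  - exact: BC.
  - exact: noinr Ay.
have oB : open_path B.
  split=> // -[x Bx hx]; apply: ng; exists (inl x) => // -[y|e] Ay.
    by rewrite le_inl; apply: hx.
  by case: (noinr e).
pose e : {A : set T | open_path A} := exist _ B oB.
apply: (noinr e).
apply: (mA (A `|` [set (inr e : T')])) => [y z|y Ay|]; [|by left|by right].
have ye x : A x -> le x (inr e : T').
  by case: x => [x|e'] Ax; [apply/le_inr|case: (noinr e')].
case=> [Ay|->] [Az|->]; [exact: tA|left; exact: ye|right; exact: ye|by left; right].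
Qed.

End AddLeaves.

Unset Implicit Arguments.

Theorem mainTheorem2 (L : language) (T : structure L)
    (hT : is_tree T) (hideal : ideal T) (hmonofolic : monofolic T)
    (hwf : well_founded_tree T) (hfocal : focal T) (hvar : variegated T) :
  (forall U : set 'I_(npred L),
     is_tree (add_leaves (@open_path L T) U) /\
     bounded_tree (add_leaves (@open_path L T) U)) /\
  (exists T' : structure L,
     [/\ is_tree T', bounded_tree T' &
         exists h : T -> T', elementary_embedding h]).
Proof.
split=> [U|]; first by split; [exact: add_leaves_tree|exact: add_leaves_bounded].
(* [U] collects the predicates common to all leaves of [T]; without leaves the condition on [U] is
   vacuous. *)
pose U : set 'I_(npred L) := [set p | exists2 c : T, leaf c & prd p c].
exists (add_leaves (@open_path L T) U); split.
- exact: add_leaves_tree.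
- exact: add_leaves_bounded.
exists inl; apply: add_leaves_elementary => // c lc p; split; last by exists c.
by move=> [c' lc' pc']; apply: (leaves_prd hT hwf hfocal lc' lc).
Qed.
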